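(* Let $J\in\{1,2,\dots\}$, let $g^1,\dots,g^J,\gamma^1,\dots,\gamma^J\in\mathbb{C}^N$, and let $\mu=\max_{\ell\in\{0,\dots,N-1\}}\max_{i\in\{1,\dots,N\}}|\chi_\ell(i)|$. If $$\sum_{j=1}^J\Big(|\hat g^j(0)+\hat\gamma^j(0)|^2-N\mu^2\|\hat g^j-\hat\gamma^j\|_2^2\Big)>0,$$ then $$\sum_{j=1}^J\langle T_i\gamma^j,T_ig^j\rangle\neq 0,\qquad\forall i=1,\dots,N.$$
   Context: Let $G=(V,E)$ be a finite, connected, undirected, weighted simple graph with vertex set $V=\{1,\dots,N\}$, and let $W=(W_{ij})$ be its weighted adjacency matrix: real, symmetric, zero diagonal, $W_{ij}\ge 0$, with $W_{ij}\neq0$ exactly when $i,j$ are adjacent. Let $D=\operatorname{diag}(d_1,\dots,d_N)$ with $d_i=\sum_{j}W_{ij}$, and let $\mathcal{L}=D-W$ be the graph Laplacian. Fix an orthonormal basis $(\chi_0,\dots,\chi_{N-1})$ of $\mathbb{C}^N$ consisting of eigenvectors of $\mathcal{L}$, ordered so that the eigenvalues satisfy $0=\lambda_0<\lambda_1\le\dots\le\lambda_{N-1}$ (so $|\chi_0(i)|=1/\sqrt N$ for all $i$). Signals are vectors $f=(f(1),\dots,f(N))\in\mathbb{C}^N$; the inner product $\langle f,h\rangle=\sum_{i=1}^N f(i)\overline{h(i)}$ is conjugate-linear in the second argument, and $\|\cdot\|_2$ is the Euclidean norm on $\mathbb{C}^N$. Graph Fourier transform: $\hat f(\ell)=\langle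 f,\chi_\ell\rangle$, $\ell=0,\dots,N-1$, with $\hat f$ regarded as a vector in $\mathbb{C}^N$; $\hat g^j$ denotes the graph Fourier transform of $g^j$ and $\hat\gamma^j$ that of $\gamma^j$ (the superscript $j$ is an index, not a power). Generalized translation, for $n\in\{1,\dots,N\}$: $(T_nf)(i)=\sqrt N\sum_{\ell=0}^{N-1}\hat f(\ell)\overline{\chi_\ell(n)}\chi_\ell(i)$. *)

(* Defs.v *)
From HB Require Import structures.
From mathcomp Require Import all_boot all_order all_algebra.
From mathcomp Require Import spectral complex.
From mathcomp Require Import reals.

Set Implicit Arguments.
Unset Strict Implicit.
Unset Printing Implicit Defensive.

Import Order.TTheory GRing.Theory Num.Theory.

Local Open Scope ring_scope.
Local Open Scope complex_scope.

(* The complex numbers are R[i] for R : realType. The N vertices, and the N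
   spectral indices 0, ..., N-1, are both represented by 'I_N; signals are row
   vectors. [dotmx f h] is the sum of the f(i) * (h(i))^*, conjugate-linear in
   its second argument. *)

Section WeightedGraph.
Variables (R : realType) (N : nat).

Definition simple_graph (e : rel 'I_N) : Prop :=
  symmetric e /\ irreflexive e.

Definition connected_graph (e : rel 'I_N) : Prop :=
  forall i j : 'I_N, connect e i j.

Definition weighted_adjacency (e : rel 'I_N) (W : 'M[R]_N) : Prop :=
  [/\ W^T = W,
      forall i, W i i = 0,
      forall i j, 0 <= W i j
    & forall i j, (W i j != 0) = e i j].

Definition degree_mx (W : 'M[R]_N) : 'M[R]_N :=
  diag_mx (\row_i \sum_j W i j).

Definition laplacian (W : 'M[R]_N) : 'M[R]_N := degree_mx W - W.

End WeightedGraph.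

Section GraphFourier.
Variable R : realType.

(* Real-valued modulus and Euclidean norm; the library's `|z| on R[i] takes its
   values in R[i]. *)
Definition cabs (z : R[i]) : R := ComplexField.Normc.normc z.

Definition norm2 N (f : 'rV[R[i]]_N) : R :=
  Num.sqrt (\sum_i cabs (f 0 i) ^+ 2).

(* N = n.+1 orthonormal vectors of C^N automatically form a basis. *)
Definition laplacian_eigenbasis n (W : 'M[R]_n.+1) (lambda : 'I_n.+1 -> R)
    (chi : 'I_n.+1 -> 'rV[R[i]]_n.+1) : Prop :=
  [/\ forall k l, dotmx (chi k) (chi l) = (k == l)%:R,
      forall l, map_mx (real_complex R) (laplacian W) *m (chi l)^T
                = (lambda l)%:C *: (chi l)^T,
      lambda ord0 = 0,
      forall l, l != ord0 -> 0 < lambda l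
    & forall k l : 'I_n.+1, (k <= l)%N -> lambda k <= lambda l].

Variables (N : nat) (chi : 'I_N -> 'rV[R[i]]_N).

Definition gft (f : 'rV[R[i]]_N) : 'rV[R[i]]_N :=
  \row_l dotmx f (chi l).

Definition translate (m : 'I_N) (f : 'rV[R[i]]_N) : 'rV[R[i]]_N :=
  \row_i ((Num.sqrt (N%:R : R))%:C
          * \sum_l gft f 0 l * (chi l 0 m)^* * chi l 0 i).

(* The seed 0 is harmless: all the moduli are nonnegative. *)
Definition coherence : R :=
  \big[Num.max/0]_l \big[Num.max/0]_i cabs (chi l 0 i).

End GraphFourier.

(* Main.v *)
Require Import Defs.
From HB Require Import structures.
From mathcomp Require Import all_boot all_order all_algebra.
From mathcomp Require Import spectral complex.
From mathcomp Require Import reals.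
From mathcomp Require Import ring.

Set Implicit Arguments.
Unset Strict Implicit.
Unset Printing Implicit Defensive.

Import Order.TTheory GRing.Theory Num.Theory.

Local Open Scope ring_scope.
Local Open Scope complex_scope.

(** The positive quantity in the hypothesis bounds from below four times the
    real part of the sum of inner products, which therefore cannot vanish.

    Translation is linear, so polarization gives
      [4 Re <T_i gamma, T_i g> = |T_i (g + gamma)|^2 - |T_i (g - gamma)|^2].
    By Parseval, |T_i f|^2 is N times the sum over l of |f^(l)|^2 |chi_l(i)|^2
    ([sqr_norm2_translate]). Bounding every |chi_l(i)| by the coherence mu gives
    [|T_i f|^2 <= N mu^2 |f^|^2] ([norm2_translate_le]). Keeping only the term
    l = 0 gives [|T_i f|^2 >= |f^(0)|^2] ([norm2_translate_ge]), because chi_0 is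
    flat: |chi_0(i)|^2 = 1/N ([sqr_cabs_chi0]). The flatness holds because the
    constant vector lies in the kernel of the Laplacian, hence is orthogonal to
    every eigenvector with a positive eigenvalue. *)

(** * Moduli, norms and inner products *)

Section Norms.
Variable R : realType.
Implicit Types (z w : R[i]).

Lemma sqr_cabsE z : (cabs z ^+ 2)%:C = z * z^*.
Proof. by rewrite -sqr_normc rmorphXn. Qed.

Lemma sqr_cabsM z w : cabs (z * w) ^+ 2 = cabs z ^+ 2 * cabs w ^+ 2.
Proof. by rewrite /cabs ComplexField.Normc.normcM exprMn. Qed.

Lemma cabs_ge0 z : 0 <= cabs z.
Proof. by case: z => a b; apply: sqrtr_ge0. Qed.

Lemma sqr_cabs_conj z : cabs z^* ^+ 2 = cabs z ^+ 2.
Proof. by case: z => a b; rewrite /cabs /= sqrrN. Qed.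

Lemma sqr_cabsC (x : R) : cabs x%:C ^+ 2 = x ^+ 2.
Proof. by rewrite /cabs /= expr0n addr0 sqr_sqrtr ?sqr_ge0. Qed.

Lemma polarization z w :
  complex.Re (z * w^*) *+ 4 = cabs (w + z) ^+ 2 - cabs (w - z) ^+ 2.
Proof.
case: z w => a b [c d]; rewrite /cabs /= !sqr_sqrtr ?addr_ge0 ?sqr_ge0 //.
by ring.
Qed.

Lemma sqr_norm2E N (f : 'rV[R[i]]_N) :
  norm2 f ^+ 2 = \sum_i cabs (f 0 i) ^+ 2.
Proof. by rewrite sqr_sqrtr ?sumr_ge0 // => i _; apply: sqr_ge0. Qed.

Lemma dotmx_sum N (f h : 'rV[R[i]]_N) :
  dotmx f h = \sum_i f 0 i * (h 0 i)^*.
Proof. by rewrite dotmxE mxE; apply: eq_bigr => i _; rewrite !mxE. Qed.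

Lemma norm2_dotmx N (f : 'rV[R[i]]_N) : (norm2 f ^+ 2)%:C = dotmx f f.
Proof.
rewrite sqr_norm2E dotmx_sum rmorph_sum.
by apply: eq_bigr => i _; apply: sqr_cabsE.
Qed.

Lemma polarization_dotmx N (f h : 'rV[R[i]]_N) :
  complex.Re (dotmx f h) *+ 4 = norm2 (h + f) ^+ 2 - norm2 (h - f) ^+ 2.
Proof.
rewrite dotmx_sum raddf_sum /= -sumrMnl !sqr_norm2E -sumrB.
by apply: eq_bigr => i _; rewrite !mxE; apply: polarization.
Qed.

End Norms.

(** * Fourier transform and translation in an orthonormal basis *)

Section Translation.
Variables (R : realType) (N : nat) (chi : 'I_N -> 'rV[R[i]]_N).
Implicit Types f h : 'rV[R[i]]_N.

Lemma gftD f h : gft chi (f + h) = gft chi f + gft chi h.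
Proof. by apply/rowP => l; rewrite !mxE linearDl. Qed.

Lemma gftB f h : gft chi (f - h) = gft chi f - gft chi h.
Proof. by apply/rowP => l; rewrite !mxE linearBl. Qed.

(** These are the Fourier coefficients of the translate of f to m, so that
    Parseval applies to translates. *)
Definition modulate (m : 'I_N) f : 'rV[R[i]]_N :=
  \row_l ((Num.sqrt (N%:R : R))%:C * gft chi f 0 l * (chi l 0 m)^*).

Definition basis_mx : 'M[R[i]]_N := \matrix_l chi l.

Lemma translateE m f : translate chi m f = modulate m f *m basis_mx.
Proof.
apply/rowP => i; rewrite [LHS]mxE [RHS]mxE mulr_sumr; apply: eq_bigr => l _.
by rewrite /modulate /basis_mx !mxE !mulrA.
Qed.

Lemma translateD m f h :
  translate chi m (f + h) = translate chi m f + translate chi m h.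
Proof.
rewrite !translateE -mulmxDl; congr (_ *m _); apply/rowP => l.
by rewrite /modulate gftD !mxE mulrDr mulrDl.
Qed.

Lemma translateB m f h :
  translate chi m (f - h) = translate chi m f - translate chi m h.
Proof.
rewrite !translateE -mulmxBl; congr (_ *m _); apply/rowP => l.
by rewrite /modulate gftB !mxE mulrBr mulrBl.
Qed.

Hypothesis chi_on : forall k l, dotmx (chi k) (chi l) = (k == l)%:R.

Lemma basis_mx_unitary : basis_mx \is unitarymx.
Proof. by apply/row_unitarymxP => k l; rewrite !rowK chi_on. Qed.

(** Parseval for the expansion of the translate in the basis. *)
Lemma sqr_norm2_translate m f :
  norm2 (translate chi m f) ^+ 2 =
  \sum_l N%:R * cabs (gft chi f 0 l) ^+ 2 * cabs (chi l 0 m) ^+ 2.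
Proof.
(* The basis matrix is unitary, hence an isometry. *)
have -> : norm2 (translate chi m f) ^+ 2 = norm2 (modulate m f) ^+ 2.
  apply: (@complexI R); rewrite !norm2_dotmx translateE !dotmxE.
  rewrite trmx_mul map_mxM mulmxA mulmxtVK //.
  exact: basis_mx_unitary.
rewrite sqr_norm2E; apply: eq_bigr => l _.
by rewrite mxE !sqr_cabsM sqr_cabs_conj sqr_cabsC sqr_sqrtr ?ler0n.
Qed.

Lemma cabs_le_coherence l m : cabs (chi l 0 m) <= coherence chi.
Proof.
apply: le_trans (le_bigmax 0 _ l).
exact: (le_bigmax 0 (fun i => cabs (chi l 0 i)) m).
Qed.

Lemma norm2_translate_le m f :
  norm2 (translate chi m f) ^+ 2 <=
  N%:R * coherence chi ^+ 2 * norm2 (gft chi f) ^+ 2.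
Proof.
rewrite sqr_norm2_translate sqr_norm2E mulr_sumr ler_sum // => l _.
rewrite mulrAC ler_wpM2r ?sqr_ge0 // ler_wpM2l ?ler0n //.
have chi_le := cabs_le_coherence l m.
by rewrite lerXn2r ?nnegrE ?cabs_ge0 // (le_trans _ chi_le) ?cabs_ge0.
Qed.

End Translation.

(** * Flatness of the ground state of the Laplacian *)

Section Laplacian.
Variable R : realType.

(** The columns of the Laplacian sum to zero: by symmetry, the column sums of
    the weights are the degrees. *)
Lemma ones_laplacian N (W : 'M[R]_N) :
  W^T = W -> (const_mx 1 : 'rV_N) *m laplacian W = 0.
Proof.
move=> W_sym; rewrite /laplacian mulmxBr mul_mx_diag; apply/rowP => j.
rewrite !mxE mul1r; apply/eqP; rewrite subr_eq0; apply/eqP.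
by apply: eq_bigr => i _; rewrite -{1}W_sym !mxE mul1r.
Qed.

Variables (n : nat) (W : 'M[R]_n.+1) (lambda : 'I_n.+1 -> R).
Variable chi : 'I_n.+1 -> 'rV[R[i]]_n.+1.
Hypothesis W_sym : W^T = W.
Hypothesis chi_basis : laplacian_eigenbasis W lambda chi.

(** Evaluate the product of the all-ones row, the Laplacian and the column
    chi_l in two ways: it is both zero and lambda_l times the sum. *)
Lemma sum_chi_eq0 l : l != ord0 -> \sum_i chi l 0 i = 0.
Proof.
case: chi_basis => _ chi_eig _ lambda_gt0 _ l_neq0.
pose one : 'rV[R[i]]_n.+1 := const_mx 1.
have oneL : one *m map_mx (real_complex R) (laplacian W) = 0.
  by rewrite /one -(rmorph1 (real_complex R)) -map_const_mx -map_mxM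
             ones_laplacian // map_mx0.
have /matrixP/(_ 0 0)/eqP : one *m ((lambda l)%:C *: (chi l)^T) = 0.
  by rewrite -chi_eig mulmxA oneL mul0mx.
rewrite -scalemxAr !mxE mulf_eq0 (fmorph_eq0 (real_complex R)).
rewrite (gt_eqF (lambda_gt0 _ l_neq0)) /= => /eqP; apply: etrans.
by apply: eq_bigr => i _; rewrite !mxE mul1r.
Qed.

(** By [sum_chi_eq0] the constant vector is a multiple of chi_0, up to
    conjugation; so all entries of the unit vector chi_0 have the same
    modulus. *)
Lemma sqr_cabs_chi0 i : n.+1%:R * cabs (chi ord0 0 i) ^+ 2 = 1.
Proof.
case: (chi_basis) => chi_on _ _ _ _.
pose s := \sum_i chi ord0 0 i.
have s_chi k : s * (chi ord0 0 k)^* = 1.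
  (* Expand the all-ones row in the conjugate basis; only index 0 survives. *)
  have U_unit : (basis_mx chi)^T \is unitarymx.
    by rewrite trmx_unitary basis_mx_unitary.
  have := mulmxtVK (const_mx 1 : 'rV_n.+1) U_unit.
  move=> /matrixP/(_ 0 k); rewrite [RHS]mxE => <-.
  rewrite [RHS]mxE big_ord_recl big1 ?addr0 => [|l _].
    rewrite !mxE; congr (_ * _).
    by apply: eq_bigr => j _; rewrite !mxE mul1r.
  have := sum_chi_eq0 (isT : lift ord0 l != ord0) => sum0.
  rewrite mxE (eq_bigr (fun j => chi (lift ord0 l) 0 j)) ?sum0 ?mul0r // => j _.
  by rewrite !mxE mul1r.
have s_sqr k : cabs s ^+ 2 * cabs (chi ord0 0 k) ^+ 2 = 1.
  rewrite -(sqr_cabs_conj (chi _ _ _)) -sqr_cabsM s_chi.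
  by rewrite /cabs ComplexField.Normc.normc1 expr1n.
have norm_chi0 : \sum_k cabs (chi ord0 0 k) ^+ 2 = 1.
  by rewrite -sqr_norm2E; apply: (@complexI R); rewrite norm2_dotmx chi_on eqxx.
have -> : n.+1%:R = cabs s ^+ 2; last exact: s_sqr.
transitivity (cabs s ^+ 2 * \sum_k cabs (chi ord0 0 k) ^+ 2).
  rewrite mulr_sumr (eq_bigr (fun=> 1)) => [|k _]; last exact: s_sqr.
  by rewrite sumr_const card_ord.
by rewrite norm_chi0 mulr1.
Qed.

Lemma norm2_translate_ge m f :
  cabs (gft chi f 0 ord0) ^+ 2 <= norm2 (translate chi m f) ^+ 2.
Proof.
case: (chi_basis) => chi_on _ _ _ _.
rewrite sqr_norm2_translate // big_ord_recl mulrAC sqr_cabs_chi0 mul1r lerDl.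
by apply: sumr_ge0 => l _; rewrite !mulr_ge0 ?ler0n ?cabs_ge0.
Qed.

End Laplacian.

Theorem lemma4p3 (R : realType) (n : nat) (e : rel 'I_n.+1)
    (W : 'M[R]_n.+1) (lambda : 'I_n.+1 -> R)
    (chi : 'I_n.+1 -> 'rV[R[i]]_n.+1)
    (e_simple : simple_graph e) (e_connected : connected_graph e)
    (W_adj : weighted_adjacency e W)
    (chi_basis : laplacian_eigenbasis W lambda chi)
    (J : nat) (J_gt0 : (0 < J)%N)
    (g gamma : 'I_J -> 'rV[R[i]]_n.+1)
    (hyp : 0 < \sum_(j < J)
             (cabs (gft chi (g j) 0 ord0 + gft chi (gamma j) 0 ord0) ^+ 2
              - n.+1%:R * coherence chi ^+ 2
                * norm2 (gft chi (g j) - gft chi (gamma j)) ^+ 2)) :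
  forall i : 'I_n.+1,
    \sum_(j < J) dotmx (translate chi i (gamma j)) (translate chi i (g j)) != 0.
Proof.
move=> i; apply/eqP => sum0.
case: (W_adj) => W_sym _ _ _; case: (chi_basis) => chi_on _ _ _ _.
suff re_gt0 : 0 < complex.Re (\sum_(j < J)
    dotmx (translate chi i (gamma j)) (translate chi i (g j))) *+ 4.
  by rewrite sum0 mul0rn ltxx in re_gt0.
apply: lt_le_trans hyp _; rewrite raddf_sum -sumrMnl; apply: ler_sum => j _.
rewrite polarization_dotmx -translateD -translateB lerB //.
  have := norm2_translate_ge W_sym chi_basis i (g j + gamma j).
  by rewrite gftD mxE.
by rewrite -gftB; apply: norm2_translate_le.
Qed.
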